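(* Let $G=\mathrm{SL}_n(\mathbb C)$ and $(u,v)\in S_n\times S_n$. Let $$S_{u,v}=\{i:\ell((u,v)s_i)<\ell(u,v)\}$$ be the set of possible terminal letters of double reduced words for $(u,v)$, where $i$ ranges over all barred and unbarred letters. For $i\in S_{u,v}$ set $$\mathbb D_i^0=G^{u,v}\setminus\bigl(G^{(u,v)s_i}x_i(\mathbb C^* )\bigr),\qquad \mathbb D_i^1=\overline{\mathbb D(G^{(u,v)s_i})\,x_i(\mathbb C^* )}^{\,G^{u,v}}$$ (closure taken in $G^{u,v}$). Then the reduced-word deep locus satisfies $$\mathbb D(G^{u,v})=\bigcap_{i\in S_{u,v}}\bigl(\mathbb D_i^0\cup\mathbb D_i^1\bigr).$$ Equivalently, $$\mathbb D(G^{u,v})=\bigcup_{k:S_{u,v}\to\{0,1\}}\ \bigcap_{i\in S_{u,v}}\mathbb D_i^{k(i)}.$$ Consequently, every irreducible component of $\mathbb D(G^{u,v})$ is contained in one of the intersections $\bigcap_{i\in S_{u,v}}\mathbb D_i^{k(i)}$ indexed by a function $k:S_{u,v}\to\{0,1\}$.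
   Context: $G=\mathrm{SL}_n(\mathbb C)$; $B$ (resp. $B^-$) is the subgroup of upper (resp. lower) triangular matrices, $H=B\cap B^-$ is the diagonal torus, $W=N_G(H)/H=S_n$ with simple reflections $s_i=(i,i+1)$ and Coxeter length $\ell$; $\ell(u,v)=\ell(u)+\ell(v)$. For $u,v\in S_n$, the double Bruhat cell is $G^{u,v}=B\dot uB\cap B^-\dot vB^-$, where $\dot w\in N_G(H)$ represents $w$. Letters are elements of $\{\bar1,\dots,\overline{n-1},1,\dots,n-1\}$. For an unbarred letter $i$: $x_i(t)=I+tE_{i,i+1}$ and $(u,v)s_i=(u,vs_i)$; for a barred letter $\bar i$: $x_{\bar i}(t)=I+tE_{i+1,i}$ and $(u,v)s_{\bar i}=(us_i,v)$. The set $R(u,v)$ of double reduced words for $(u,v)$ consists of the words $\mathbf i=(i_1,\dots,i_m)$, $m=\ell(u)+\ell(v)$, in these letters whose barred subword is a reduced word of $u$ (bars removed) and whose unbarred subword is a reduced word of $v$; the terminal letter of $\mathbf i$ is $i_m$. Put $T_{\mathbf i}=\{h\,x_{i_1}(t_1)\cdots x_{i_m}(t_m): h\in H,\ t_k\in\mathbb C^*\}\subset G^{u,v}$. The reduced-word deep locus is $\mathbb D(G^{u,v})=G^{u,v}\setminus\bigcup_{\mathbf i\in R(u,v)}T_{\mathbf i}$. Here $x_i(\mathbb C^* )=\{x_i(t):t\in\mathbb C^*\}$, and $G^{(u,v)s_i}x_i(\mathbb C^* )\subset G^{u,v}$ and $\mathbb D(G^{(u,v)s_i})\,x_i(\mathbb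 C^* )\subset G^{u,v}$ are the sets of products.
   Formalization: The two displayed equalities are stated for (u,v) ≠ (e,e): at (e,e) the set S_{u,v} is empty, the deep locus is empty, but the empty intersection is all of G^{e,e}=H, so they fail there; the claim on irreducible components is kept for all (u,v). *)

(* Defs.v *)
From mathcomp Require Import all_boot all_order all_fingroup all_algebra.
From mathcomp Require Import boolp classical_sets reals complex mpoly.

Set Implicit Arguments.
Unset Strict Implicit.
Unset Printing Implicit Defensive.

Import Order.TTheory GRing.Theory Num.Theory.

Local Open Scope ring_scope.

(* The group is SL_n with n = r.+1, over the complex numbers R[i], R : realType.
   Indices are 0-based: [simple_refl i], for i : 'I_r, is the simple reflection
   written (i+1, i+2) with 1-based indices.

   Products in 'S_n are MathComp's (left factor applied first).  With this
   convention [perm_mx], whose (i, j) entry is [w i == j], is multiplicative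
   (perm_mxM), so 'S_n, with its product *, is W = N_G(H)/H through
   w |-> class of the matrices of permutation pattern [perm_mx w]. *)

Section Weyl.
Variable r : nat.

Definition simple_refl (i : 'I_r) : 'S_r.+1 :=
  tperm (widen_ord (leqnSn r) i) (lift ord0 i).

Definition word_prod (s : seq 'I_r) : 'S_r.+1 :=
  (\prod_(i <- s) simple_refl i)%g.

Definition has_word_of_size (w : 'S_r.+1) : pred nat :=
  fun k => [exists s : k.-tuple 'I_r, word_prod s == w].

Lemma gen_simple : <<[set simple_refl i | i in 'I_r]>>%g = [set: 'S_r.+1].
Proof.
apply/eqP; rewrite finset.eqEsubset finset.subsetT -(gen_tperm ord0) gen_subG.
apply/fintype.subsetP => _ /imsetP[y _ ->].
have [k] := ubnP (y : nat); elim: k y => // k IHk y ltyk.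
have [->|y_neq0] := eqVneq y ord0; first by rewrite tperm1 group1.
have y_gt0 : (0 < y)%N by rewrite lt0n.
have ltyr : (y.-1 < r)%N by rewrite -ltnS prednK.
set i := Ordinal ltyr; set z := widen_ord (leqnSn r) i.
have Dy : lift ord0 i = y by apply: val_inj; rewrite /= /bump /= add1n prednK.
have s_in : simple_refl i \in <<[set simple_refl i | i in 'I_r]>>%g.
  by apply: mem_gen; apply: imset_f.
have z_in : tperm ord0 z \in <<[set simple_refl i | i in 'I_r]>>%g.
  by apply: IHk; rewrite /= -ltnS prednK.
have [z0|z_neq0] := eqVneq z ord0.
  by move: s_in; rewrite /simple_refl Dy -/z z0.
suff -> : tperm ord0 y = (tperm ord0 z ^ simple_refl i)%g by rewrite groupJ.
by rewrite tpermJ /simple_refl Dy -/z tpermL tpermD.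
Qed.

Lemma has_word (w : 'S_r.+1) : exists k, has_word_of_size w k.
Proof.
have: w \in <<[set simple_refl i | i in 'I_r]>>%g by rewrite gen_simple inE.
case/gen_prodgP => k [c c_in ->]; exists k; apply/existsP.
have c_simple j : exists i, c j == simple_refl i.
  by have /imsetP[i _ ->] := c_in j; exists i.
exists [tuple xchoose (c_simple j) | j < k]; apply/eqP.
rewrite /word_prod big_tuple; apply: eq_bigr => j _; rewrite tnth_mktuple.
by apply/eqP; rewrite eq_sym; exact: (xchooseP (c_simple j)).
Qed.

Definition coxeter_length (w : 'S_r.+1) : nat := ex_minn (has_word w).

Definition coxeter_length2 (uv : 'S_r.+1 * 'S_r.+1) : nat :=
  (coxeter_length uv.1 + coxeter_length uv.2)%N.

Definition reduced_word (w : 'S_r.+1) (s : seq 'I_r) : Prop :=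
  word_prod s = w /\ size s = coxeter_length w.

(* (true, i) is the barred letter, (false, i) the unbarred one *)
Definition letter : finType := (bool * 'I_r)%type.

Definition mul_letter (uv : 'S_r.+1 * 'S_r.+1) (i : letter) :=
  if i.1 then ((uv.1 * simple_refl i.2)%g, uv.2)
  else (uv.1, (uv.2 * simple_refl i.2)%g).

Definition barred_subword (w : seq letter) : seq 'I_r :=
  [seq i.2 | i <- w & i.1].
Definition unbarred_subword (w : seq letter) : seq 'I_r :=
  [seq i.2 | i <- w & ~~ i.1].

Definition double_reduced_words (uv : 'S_r.+1 * 'S_r.+1) : set (seq letter) :=
  [set w | reduced_word uv.1 (barred_subword w) /\
           reduced_word uv.2 (unbarred_subword w)]%classic.

Definition terminal_letters (uv : 'S_r.+1 * 'S_r.+1) : {set letter} :=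
  [set i | (coxeter_length2 (mul_letter uv i) < coxeter_length2 uv)%N].

End Weyl.

Section DoubleBruhat.
Local Open Scope classical_set_scope.
Variables (R : realType) (r : nat).
Local Notation C := R[i].
Local Notation M := 'M[C]_r.+1.

Definition SL : set M := [set g | \det g = 1].
(* MathComp's [is_trig_mx] means lower triangular. *)
Definition Bplus : set M := SL `&` [set g | is_trig_mx g^T].
Definition Bminus : set M := SL `&` [set g | is_trig_mx g].
Definition torus : set M := Bplus `&` Bminus.

(* The elements of N_G(H) in the class w of W = N_G(H)/H; the diagonal factor
   is needed because [perm_mx w] has determinant -1 for odd w. *)
Definition representatives (w : 'S_r.+1) : set M :=
  SL `&` [set g | exists d : 'rV[C]_r.+1, g = diag_mx d * perm_mx w].

Definition double_coset (K : set M) (w : 'S_r.+1) : set M :=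
  [set g | exists b1 wdot b2,
     [/\ K b1, representatives w wdot, K b2 & g = b1 * wdot * b2]].

Definition bruhat_cell (uv : 'S_r.+1 * 'S_r.+1) : set M :=
  double_coset Bplus uv.1 `&` double_coset Bminus uv.2.

Definition x_ (i : letter r) (t : C) : M :=
  let a := widen_ord (leqnSn r) i.2 in
  let b := lift ord0 i.2 in
  1 + t *: (if i.1 then delta_mx b a else delta_mx a b).

Definition x_Cstar (i : letter r) : set M :=
  [set x_ i t | t in [set t | t != 0]].

Definition set_mul (A A' : set M) : set M :=
  [set a * a' | a in A & a' in A'].

Definition torus_chart (w : seq (letter r)) : set M :=
  [set g | exists h (t : seq C),
     [/\ torus h, size t = size w, all (fun z => z != 0) t
       & g = h * \prod_(p <- zip w t) x_ p.1 p.2]].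

Definition deep_locus (uv : 'S_r.+1 * 'S_r.+1) : set M :=
  bruhat_cell uv `\` \bigcup_(w in double_reduced_words uv) torus_chart w.

(* Zariski topology of the affine space of matrices; subsets get the subspace
   topology. *)
Definition zariski_closed (Z : set M) : Prop :=
  exists P : set {mpoly C[r.+1 * r.+1]},
    Z = [set g | forall p, P p -> p.@[mxvec g 0] = 0].

Definition closure_in (X A : set M) : set M :=
  X `&` \bigcap_(Z in [set Z | zariski_closed Z /\ A `<=` Z]) Z.

Definition irreducible (Y : set M) : Prop :=
  Y !=set0 /\
  forall Z1 Z2, zariski_closed Z1 -> zariski_closed Z2 ->
    Y `<=` Z1 `|` Z2 -> Y `<=` Z1 \/ Y `<=` Z2.

Definition irreducible_component (X Y : set M) : Prop :=
  [/\ Y `<=` X, irreducible Y &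
      forall Y', Y' `<=` X -> irreducible Y' -> Y `<=` Y' -> Y' = Y].

Definition D0 (uv : 'S_r.+1 * 'S_r.+1) (i : letter r) : set M :=
  bruhat_cell uv `\` set_mul (bruhat_cell (mul_letter uv i)) (x_Cstar i).

Definition D1 (uv : 'S_r.+1 * 'S_r.+1) (i : letter r) : set M :=
  closure_in (bruhat_cell uv)
    (set_mul (deep_locus (mul_letter uv i)) (x_Cstar i)).

(* false stands for the exponent 0, true for 1 *)
Definition Dk (uv : 'S_r.+1 * 'S_r.+1) (i : letter r) (k : bool) : set M :=
  if k then D1 uv i else D0 uv i.

End DoubleBruhat.

Arguments deep_locus R {r} uv.
Arguments D0 R {r} uv i.
Arguments D1 R {r} uv i.
Arguments Dk R {r} uv i k.

(* Main.v *)
Require Import Defs.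
From mathcomp Require Import all_boot all_order all_fingroup all_algebra.
From mathcomp Require Import boolp classical_sets reals complex mpoly.
From mathcomp Require Import zify ring.

(** Removing the last letter i of a double reduced word for (u, v) leaves a
double reduced word for (u, v)s_i, and i is a terminal letter. So the charts of
G^{u,v} are the sets T x_i(t), t <> 0, where i is a terminal letter and T a
chart of G^{(u,v)s_i}. A factorization g = g' x_i(t) with g' in G^{(u,v)s_i} is
unique. Hence g lies on no chart whose word ends in i if and only if either it
has no such factorization, which is D_i^0, or its factor g' is deep. The points
of the second kind belong to D_i^1, so everything reduces to one fact: the
closure that defines D_i^1 contains no point of a chart whose word ends in i.
This holds because each chart is cut out of its double Bruhat cell by the
nonvanishing of a single polynomial ([torus_chart_equation]).

These polynomials are built letter by letter. Let i be unbarred, so that i is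
a descent of v (a barred letter is the same situation for u and the reversed
order of the coordinates). Let f be the minor of g on the columns after the
i-th and on the rows that v sends to these columns. It vanishes nowhere on
B^- v B^- and everywhere on B^- vs_i B^-, while f(g s_i) vanishes nowhere on
the latter, and f(g x_i(t)) = f(g) + t f(g s_i). Consequently:
- if g = g' x_i(t) with g' in B^- vs_i B^-, then f(g s_i) = f(g' s_i) <> 0 and
  t = f(g) / f(g s_i), whence the uniqueness;
- if g is in B^- v B^- and f(g s_i) <> 0, put t = f(g) / f(g s_i). A
  computation in the 2 x 2 block of i shows that g x_i(-t) is in B^- v B^- or
  in B^- vs_i B^-, and f vanishes on it, so that it is in the latter.
Therefore G^{(u,v)s_i} x_i(t), t <> 0, is the open subset f(g s_i) <> 0 of
G^{u,v}, and on it g' is a rational function of g. Substituting it into the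
equation of the shorter word, clearing denominators and multiplying by
f(g s_i) gives the equation of the longer word. To clear denominators, the zero
locus of each equation has to be stable under scaling, which is part of the
induction.

The same description shows that D_i^0 is closed in G^{u,v}, as D_i^1 is by
definition. An irreducible subset of the deep locus, being covered by the two,
lies in one of them for each i, which gives the statement on components.

Lengths are turned into positions by the exchange property ([word_exchange]): if
multiplying by s_i makes w longer, then w^-1 preserves the order of the two
coordinates exchanged by s_i. *)

Set Implicit Arguments.
Unset Strict Implicit.
Unset Printing Implicit Defensive.

(** * Triangular and elementary matrices *)

Section Triangular.
Import GRing.Theory.
Local Open Scope ring_scope.
Variables (F : fieldType) (n : nat).
Implicit Types (A B : 'M[F]_n) (key : 'I_n -> nat).

(** An arbitrary key makes one notion cover both triangular shapes as well as
the reorderings of coordinates under which the minors below are evaluated. *)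
Definition triangular key A := forall p q, (key p < key q)%N -> A p q = 0.

(** A permutation preserves the sum of the keys, so unless it is the identity it
sends some row to a column of larger key, and its term in the Leibniz formula vanishes. *)
Lemma det_triangular key A :
  injective key -> triangular key A -> \det A = \prod_p A p p.
Proof.
move=> key_inj A_tri; rewrite /determinant (bigD1 1%g) //= odd_perm1 mul1r.
rewrite [X in _ + X]big1 ?addr0 => [|s s_neq1].
  by apply: eq_bigr => p _; rewrite perm1.
suff /existsP[p ltp] : [exists p, key p < key (s p)]%N.
  by rewrite (bigD1 p) //= (A_tri _ _ ltp) mul0r mulr0.
apply/contraT => /existsPn no_incr; case/negP: s_neq1; apply/eqP/permP => p.
rewrite perm1; apply: key_inj; apply/eqP.
have le_key q : true ->
    (key (s q) <= key q ?= iff (key (s q) == key q))%N.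
  by move=> _; split=> //; rewrite leqNgt no_incr.
have [_] := leqif_sum le_key.
by rewrite [X in X == _](reindex_inj (@perm_inj _ s^-1%g)) /= (eq_bigr key) ?eqxx
  => [/esym/forallP/(_ p)//|q _]; rewrite permKV.
Qed.

Lemma triangular_mul key A B :
  triangular key A -> triangular key B -> triangular key (A *m B).
Proof.
move=> A_tri B_tri p q ltpq; rewrite mxE big1 // => k _.
have [ltpk|lekp] := ltnP (key p) (key k); first by rewrite A_tri ?mul0r.
by rewrite B_tri ?mulr0 // (leq_ltn_trans lekp).
Qed.

Lemma triangular_diag key A :
  injective key -> triangular key A -> A \in unitmx -> forall p, A p p != 0.
Proof.
move=> key_inj A_tri; rewrite unitmxE (det_triangular key_inj) // unitfE.
by move=> /prodf_neq0 + p => /(_ p isT).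
Qed.

(** Forward substitution: row p of [A *m invmx A = 1%:M] expresses row p of the
inverse through the rows of smaller key. *)
Lemma triangular_inv key A :
  injective key -> triangular key A -> A \in unitmx -> triangular key (invmx A).
Proof.
move=> key_inj A_tri Au p q.
have [m] := ubnP (key p); elim: m p => // m IHm p le_pm ltpq.
have: (A *m invmx A) p q = 0.
  by rewrite mulmxV // mxE; case: eqP ltpq => // ->; rewrite ltnn.
rewrite mxE (bigD1 p) //= big1 => [|k neq_kp].
  move/eqP; rewrite addr0 mulf_eq0 => /orP[|/eqP//].
  by rewrite (negPf (triangular_diag key_inj A_tri Au p)).
have [ltpk|] := ltnP (key p) (key k); first by rewrite A_tri ?mul0r.
rewrite leq_eqVlt => /orP[/eqP/key_inj eq_kp|ltkp].
  by rewrite eq_kp eqxx in neq_kp.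
by rewrite IHm ?mulr0 //; lia.
Qed.

Lemma triangular1 key : triangular key 1%:M.
Proof. by move=> p q ltpq; rewrite mxE; case: eqP ltpq => [->|//]; rewrite ltnn. Qed.

Definition elementary (a b : 'I_n) (t : F) : 'M[F]_n := 1 + t *: delta_mx a b.

Lemma mul_mx_elementary a b t A p q :
  (A *m elementary a b t) p q = A p q + t * A p a *+ (q == b).
Proof.
rewrite mulmxDr mulmx1 -scalemxAr !mxE (bigD1 a) //= big1 ?addr0.
  by rewrite mxE eqxx /= mulr_natr mulrnAr.
by move=> k /negPf neq; rewrite mxE neq mulr0.
Qed.

Lemma mul_elementary_mx a b t A p q :
  (elementary a b t *m A) p q = A p q + t * A b q *+ (p == a).
Proof.
rewrite mulmxDl mul1mx -scalemxAl !mxE (bigD1 b) //= big1 ?addr0.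
  by rewrite mxE eqxx andbT /= mulr_natl mulrnAr.
by move=> k /negPf neq; rewrite mxE neq andbF mul0r.
Qed.

Lemma elementaryK a b t : a != b ->
  elementary a b t *m elementary a b (- t) = 1%:M.
Proof.
move=> neq_ab; rewrite /elementary mulmxDl mul1mx mulmxDr mulmx1 -scalemxAl -scalemxAr.
rewrite mul_delta_mx_cond eq_sym (negPf neq_ab) !scaler0 addr0 scaleNr.
by rewrite -addrA addNr addr0.
Qed.

Lemma elementary_unit a b t : a != b -> elementary a b t \in unitmx.
Proof. by move/(elementaryK t)/mulmx1_unit => []. Qed.

Lemma elementary_triangular key a b t :
  (key b < key a)%N -> triangular key (elementary a b t).
Proof.
move=> lt_ba p q ltpq; rewrite -[elementary _ _ _]mul1mx mul_mx_elementary.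
rewrite (@triangular1 key p q ltpq) add0r mxE.
case: eqP => [eq_pa|]; last by rewrite mulr0 mul0rn.
by case: eqP => // eq_qb; move: ltpq lt_ba; rewrite eq_pa eq_qb; lia.
Qed.

Lemma mul_perm_mx (w : 'S_n) A p q : (perm_mx w *m A) p q = A (w p) q.
Proof. by rewrite -row_permE mxE. Qed.

Lemma mul_mx_perm (w : 'S_n) A p q : (A *m perm_mx w) p q = A p (w^-1 q)%g.
Proof. by rewrite -[w in LHS]invgK -col_permE mxE. Qed.

End Triangular.

(** * Double cosets of Borel subgroups and flag minors *)

Section Borel.
Import GRing.Theory.
Local Open Scope ring_scope.
Variables (F : fieldType) (n : nat) (rho : 'I_n -> 'I_n).
Hypothesis rho_inj : injective rho.
Implicit Types (g A B : 'M[F]_n) (w v : 'S_n).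
Let rk (p : 'I_n) : nat := rho p.
Let rk_inj : injective rk. Proof. by move=> p q /val_inj/rho_inj. Qed.

(** For varying [rho], these are the Borel subgroups of GL_n that contain the
diagonal torus. *)
Definition borel A := triangular rho A /\ A \in unitmx.

Lemma borel_mul A B : borel A -> borel B -> borel (A *m B).
Proof.
move=> [trA uA] [trB uB]; split; last by rewrite unitmx_mul uA.
exact: triangular_mul.
Qed.

(** The Bruhat cell of w in GL_n. Letting the two factors be invertible, rather
than of determinant 1, avoids any choice of sign for the permutation matrix. *)
Definition in_cell w g :=
  exists b1 b2, [/\ borel b1, borel b2 & g = b1 *m perm_mx w *m b2].

Lemma in_cell_mulr w g A : borel A -> in_cell w g -> in_cell w (g *m A).
Proof.
move=> bA [b1 [b2 [bb1 bb2 ->]]]; exists b1, (b2 *m A); split=> //.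
  exact: borel_mul.
by rewrite mulmxA.
Qed.

Variables (lo hi : 'I_n).
Hypothesis lo_hi : rho hi = (rho lo).+1 :> nat.
Local Notation s := (tperm lo hi).
Local Notation x := (elementary lo hi).

Lemma neq_lohi : lo != hi.
Proof. by apply: contra_eqN lo_hi => /eqP->; lia. Qed.

Lemma rho_eq p q : rho p = rho q :> nat -> p = q.
Proof. by move/val_inj/rho_inj. Qed.

(** The algebra of matrices whose units form the minimal parabolic subgroup with
Levi block {lo, hi}. *)
Definition parabolic A :=
  forall p q, (rho p < rho q)%N -> (p, q) != (lo, hi) -> A p q = 0.

Lemma triangular_parabolic A : triangular rho A -> parabolic A.
Proof. by move=> trA p q /trA. Qed.

Lemma parabolic_triangular A : parabolic A -> A lo hi = 0 -> triangular rho A.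
Proof. by move=> parA A0 p q /parA; case: eqP => [[-> ->]|_ ->]. Qed.

Lemma parabolic_mul A B : parabolic A -> parabolic B -> parabolic (A *m B).
Proof.
move=> parA parB p q ltpq ne; rewrite mxE big1 // => k _.
have [ltpk|lekp] := ltnP (rho p) (rho k); last first.
  rewrite parB ?mulr0 ?(leq_ltn_trans lekp) //.
  apply: contraNneq ne => -[eq_k eq_q]; move: lekp ltpq.
  rewrite eq_k eq_q lo_hi ltnS => le1 le2.
  by rewrite (@rho_eq p lo) ?eqxx //; apply/eqP; rewrite eqn_leq le1 le2.
have [[eq_p eq_k]|/eqP neq] := eqVneq (p, k) (lo, hi); last first.
  by rewrite parA ?mul0r //; apply/eqP.
rewrite parB ?mulr0 //.
  rewrite eq_k ltn_neqAle lo_hi -eq_p ltpq andbT eq_p -lo_hi.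
  by apply: contraNneq ne => /rho_eq <-; rewrite eq_p eqxx.
by rewrite eq_k xpair_eqE eq_sym (negPf neq_lohi).
Qed.

Lemma parabolic_elementary t : parabolic (x t).
Proof.
move=> p q ltpq ne; rewrite -[x t]mul1mx mul_mx_elementary.
rewrite (@triangular1 _ _ rho p q ltpq) add0r mxE.
case: (p =P lo) => [eq_p|_]; last by rewrite mulr0 mul0rn.
by case: (q =P hi) => // eq_q; rewrite eq_p eq_q eqxx in ne.
Qed.

Lemma parabolic_perm : parabolic (perm_mx s : 'M[F]_n).
Proof.
move=> p q ltpq ne; rewrite !mxE; case: eqP => // eq_q; move: ltpq ne.
rewrite -eq_q; case: tpermP => [->|->|_ _]; rewrite ?eqxx //.
  by rewrite lo_hi ltnNge leqnSn.
by rewrite ltnn.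
Qed.

Lemma mul_perm_elementary w a b (t : F) :
  perm_mx w *m elementary a b t =
  elementary (w^-1 a)%g (w^-1 b)%g t *m perm_mx w.
Proof.
apply/matrixP => p q; rewrite mul_mx_elementary mul_mx_perm !mxE.
rewrite (inj_eq perm_inj) -[p == (w^-1 q)%g](inj_eq (@perm_inj _ w)) permKV.
rewrite -[p == (w^-1 a)%g](inj_eq (@perm_inj _ w)) permKV.
by case: (w p == a); case: (q == b); rewrite /= ?mulr0 ?mul0rn.
Qed.

(** The (lo, hi) entry of [A *m x t] is [t * A lo lo], hence a valid pivot:
subtracting k times row lo from row hi clears the (hi, hi) entry, and exchanging
the two rows then makes the matrix triangular. No row operation is needed when
the (hi, hi) entry, which is [A hi hi + t * A hi lo], is already zero. *)
Lemma borel_elementary_swap A t : borel A -> t != 0 ->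
  exists k B, [/\ borel B, A *m x t = elementary hi lo k *m perm_mx s *m B &
    A hi hi + t * A hi lo = 0 -> k = 0].
Proof.
move=> [trA uA] t_neq0.
have neq_hilo : hi != lo by rewrite eq_sym neq_lohi.
have Alo := triangular_diag rk_inj trA uA lo.
pose k := (A hi hi + t * A hi lo) / (t * A lo lo).
exists k, (perm_mx s *m (elementary hi lo (- k) *m (A *m x t))); split.
- split; last by rewrite !unitmx_mul unitmx_perm !elementary_unit ?neq_lohi ?uA.
  apply: parabolic_triangular.
    apply: parabolic_mul parabolic_perm _; apply: parabolic_mul.
      by apply: triangular_parabolic; apply: elementary_triangular; rewrite lo_hi.
    by apply: parabolic_mul (parabolic_elementary t); apply: triangular_parabolic.
  rewrite mul_perm_mx tpermL mul_elementary_mx !mul_mx_elementary !eqxx !mulr1n.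
  rewrite (trA lo hi) ?lo_hi // /k; field; exact/andP.
- rewrite -!mulmxA (mulmxA (perm_mx s)) -perm_mxM tperm2 perm_mx1 mul1mx.
  by rewrite (mulmxA (elementary _ _ _)) elementaryK // mul1mx.
- by move=> num0; rewrite /k num0 mul0r.
Qed.

(** Here the (hi, hi) entry of [A *m x t] is the pivot, and it clears the
(lo, hi) entry. *)
Lemma borel_elementary_pass A t : borel A -> A hi hi + t * A hi lo != 0 ->
  exists k B, borel B /\ A *m x t = x k *m B.
Proof.
move=> [trA uA] d_neq0; pose k := t * A lo lo / (A hi hi + t * A hi lo).
exists k, (x (- k) *m (A *m x t)); split; last first.
  by rewrite !mulmxA elementaryK ?neq_lohi // mul1mx.
split; last by rewrite !unitmx_mul !elementary_unit ?neq_lohi ?uA.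
apply: parabolic_triangular.
  apply: parabolic_mul (parabolic_elementary _) _.
  by apply: parabolic_mul (parabolic_elementary _); apply: triangular_parabolic.
rewrite mul_elementary_mx !mul_mx_elementary !eqxx !mulr1n.
by rewrite (trA lo hi) ?lo_hi // /k; field.
Qed.

(** The row operation left over by [borel_elementary_swap] moves through w into
the left Borel factor because w^-1 preserves the order of lo and hi. *)
Lemma in_cell_ascent w g t :
    (rho (w^-1 lo)%g < rho (w^-1 hi)%g)%N -> t != 0 ->
  in_cell w g -> in_cell (w * s)%g (g *m x t).
Proof.
move=> asc t_neq0 [b1 [b2 [bb1 bb2 ->]]].
have [k [B [bB Dx _]]] := borel_elementary_swap bb2 t_neq0.
exists (b1 *m elementary (w^-1 hi)%g (w^-1 lo)%g k), B; split=> //.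
  apply: borel_mul bb1 _; split; first exact: elementary_triangular.
  by rewrite elementary_unit // (inj_eq perm_inj) eq_sym neq_lohi.
by rewrite -mulmxA Dx perm_mxM !mulmxA -(mulmxA b1 (perm_mx w))
  mul_perm_elementary !mulmxA.
Qed.

(** Now it is the row operation of [borel_elementary_pass] that moves through w;
if its pivot is zero, [borel_elementary_swap] leaves no row operation at all. *)
Lemma in_cell_descent w g t :
    (rho (w^-1 hi)%g < rho (w^-1 lo)%g)%N ->
  in_cell w g -> in_cell w (g *m x t) \/ in_cell (w * s)%g (g *m x t).
Proof.
move=> desc [b1 [b2 [bb1 bb2 ->]]].
have [d0|d_neq0] := eqVneq (b2 hi hi + t * b2 hi lo) 0; last first.
  left; have [k [B [bB Dx]]] := borel_elementary_pass bb2 d_neq0.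
  exists (b1 *m elementary (w^-1 lo)%g (w^-1 hi)%g k), B; split=> //.
    apply: borel_mul bb1 _; split; first exact: elementary_triangular.
    by rewrite elementary_unit // (inj_eq perm_inj) neq_lohi.
  by rewrite -mulmxA Dx !mulmxA -(mulmxA b1 (perm_mx w)) mul_perm_elementary !mulmxA.
right; have t_neq0 : t != 0.
  apply: contra_eq_neq d0 => ->; rewrite mul0r addr0.
  by case: bb2 => tr2 u2; exact: (triangular_diag rk_inj tr2 u2 hi).
have [k [B [bB Dx k0]]] := borel_elementary_swap bb2 t_neq0.
exists b1, B; split=> //; rewrite -mulmxA Dx k0 // perm_mxM !mulmxA.
by rewrite /elementary scale0r addr0 mulmx1.
Qed.

Variable v : 'S_n.
Hypothesis v_desc : (rho (v^-1 hi)%g < rho (v^-1 lo)%g)%N.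

Definition mixed_mx (A B : 'M[F]_n) : 'M[F]_n :=
  \matrix_(p, q) if (rho hi <= rho q)%N then A p q else B p q.

(** Up to sign, the minor of g on the columns q with [rho hi <= rho q] and the
rows that v sends to these columns: the remaining columns are replaced by the
unit vectors of the remaining rows. *)
Definition flag_minor g := \det (mixed_mx g (perm_mx v)).

Lemma mul_mixed_mx A B C : C *m mixed_mx A B = mixed_mx (C *m A) (C *m B).
Proof.
apply/matrixP => p q; rewrite !mxE; case: ifP => cq.
all: by apply: eq_bigr => k _; rewrite mxE cq.
Qed.

(** The matrix is triangular once the coordinates up to hi are ordered by their
images under v^-1 and put before the others. The entry (lo, hi) of A, possibly
nonzero, is then on the right side of the diagonal because v^-1 reverses the
order of lo and hi. *)
Lemma det_mixed_parabolic A b : parabolic A -> triangular rho b ->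
  \det (mixed_mx A (perm_mx v^-1 *m b *m perm_mx v)) =
  \prod_p (if (rho hi <= rho p)%N then A p p else b (v^-1 p)%g (v^-1 p)%g).
Proof.
move=> parA trb.
(* Adding n puts the coordinates after hi behind all those up to hi. *)
pose key p := (if rho hi < rho p then n + rho p else rho (v^-1 p)%g)%N.
have vV_inj : injective (v^-1)%g by exact: perm_inj.
rewrite (@det_triangular _ _ key) => [|p q|p q].
- by apply: eq_bigr => p _; rewrite mxE mul_mx_perm mul_perm_mx.
- rewrite /key; have := ltn_ord (rho (v^-1 p)%g); have := ltn_ord (rho (v^-1 q)%g).
  case: ifP => _; case: ifP => _ lt1 lt2 eqk; try lia.
    by apply: rho_eq; lia.
  by apply: vV_inj; apply: rho_eq.
have [<- // | neq_pq] := eqVneq p q; first by rewrite ltnn.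
rewrite mxE mul_mx_perm mul_perm_mx /key.
have := ltn_ord (rho (v^-1 p)%g); have := ltn_ord (rho (v^-1 q)%g).
case: (ltngtP (rho hi) (rho q)) => [lthq|ltqh|/rho_eq <-] /=.
- move=> ltvq ltvp; case: ifP => [lthp|/negbT lehp] lt_key; apply: parA; try lia.
    by apply: contraTneq lthq => -[_ ->]; rewrite ltnn.
  by apply: contraTneq lthq => -[_ ->]; rewrite ltnn.
- by move=> ltvq ltvp; case: ifP => _ lt_key; apply: trb; lia.
move=> ltvh ltvp; case: ifP => [|/negbT]; first by lia.
rewrite -leqNgt => le_ph lt_key; apply: parA.
  rewrite ltn_neqAle le_ph andbT; apply: contraTneq lt_key => /rho_eq->.
  by rewrite ltnn.
rewrite xpair_eqE eqxx andbT; apply: contraTneq lt_key => ->; lia.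
Qed.

(** Clearing the factor b brings the minor into the form evaluated by
[det_mixed_parabolic]. *)
Lemma flag_minor_mul_eq0 b A : b \in unitmx ->
  (flag_minor (b *m A) == 0) =
  (\det (mixed_mx (perm_mx v^-1 *m A)
                  (perm_mx v^-1 *m invmx b *m perm_mx v)) == 0).
Proof.
move=> ub; rewrite -[A in RHS](mulKmx ub) (mulmxA (perm_mx _)).
rewrite -mul_mixed_mx det_mulmx mulf_eq0.
suff /negPf-> : \det (perm_mx v^-1 *m invmx b) != 0 by [].
by rewrite -unitfE -unitmxE unitmx_mul unitmx_perm unitmx_inv.
Qed.

Lemma flag_minor_cell g : in_cell v g -> flag_minor g != 0.
Proof.
move=> [b1 [b2 [[tr1 u1] [tr2 u2] ->]]]; rewrite -mulmxA flag_minor_mul_eq0 //.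
rewrite mulmxA -perm_mxM mulVg perm_mx1 mul1mx.
have trV := triangular_inv rk_inj tr1 u1.
rewrite det_mixed_parabolic //; last exact: triangular_parabolic.
apply/prodf_neq0 => p _; case: ifP => _; first exact: (triangular_diag rk_inj).
by apply: (triangular_diag rk_inj trV); rewrite unitmx_inv.
Qed.

(** The minor reduces to the determinant of a triangular matrix with diagonal
entry [b2 lo hi = 0] at hi; multiplying g by s replaces this entry by
[b2 lo lo]. *)
Lemma flag_minor_cell_swap g : in_cell (v * s)%g g ->
  flag_minor g = 0 /\ flag_minor (g *m perm_mx s) != 0.
Proof.
move=> [b1 [b2 [[tr1 u1] [tr2 u2] ->]]].
have trV := triangular_inv rk_inj tr1 u1.
have par_s : parabolic (perm_mx s *m b2).
  by apply: parabolic_mul parabolic_perm _; exact: triangular_parabolic.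
rewrite -!mulmxA; split; [apply/eqP | ]; rewrite flag_minor_mul_eq0 //;
  rewrite perm_mxM !mulmxA -perm_mxM mulVg perm_mx1 mul1mx.
  rewrite det_mixed_parabolic // (bigD1 hi) //= leqnn mul_perm_mx tpermR.
  by rewrite (trV, tr2) ?lo_hi // mul0r.
rewrite det_mixed_parabolic //; last exact: parabolic_mul par_s parabolic_perm.
apply/prodf_neq0 => p _; case: ifP => _.
  by rewrite mul_mx_perm tpermV mul_perm_mx; exact: (triangular_diag rk_inj).
by apply: (triangular_diag rk_inj trV); rewrite unitmx_inv.
Qed.

(** Only column hi changes, and the minor is linear in it. *)
Lemma flag_minor_elementary g t :
  flag_minor (g *m x t) = flag_minor g + t * flag_minor (g *m perm_mx s).
Proof.
have Dx := mul_mx_elementary lo hi t g.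
have Ds p q : (g *m perm_mx s) p q = g p (s q) by rewrite mul_mx_perm tpermV.
move: (g *m x t) (g *m perm_mx s) Dx Ds => gx gs Dx Ds.
rewrite -[flag_minor g]mul1r -![flag_minor _]det_tr.
apply: (determinant_multilinear (i0 := hi)); apply/matrixP => p q; rewrite !mxE.
- by rewrite leqnn Dx Ds tpermR eqxx mul1r.
- by rewrite Dx [lift _ _ == _]eq_sym (negPf (neq_lift _ _)) addr0.
- rewrite Dx Ds [lift _ _ == _]eq_sym (negPf (neq_lift _ _)) addr0.
  case: ifP => // le_hi; case: tpermP => // [eq_lo|eq_hi].
    by rewrite eq_lo lo_hi ltnn in le_hi.
  by have := neq_lift hi p; rewrite eq_hi eqxx.
Qed.

Lemma flag_minor_elementary_swap g t :
  flag_minor (g *m x t *m perm_mx s) = flag_minor (g *m perm_mx s).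
Proof.
congr (\det _); apply/matrixP => p q.
rewrite [LHS]mxE [RHS]mxE; case: ifP => // le_hi.
rewrite !mul_mx_perm tpermV mul_mx_elementary; case: tpermP => [eq_q|_|_ /eqP/negPf->].
- by rewrite eq_q lo_hi ltnn in le_hi.
- by rewrite (negPf neq_lohi) addr0.
- by rewrite addr0.
Qed.

(** The minor is homogeneous; only the nonvanishing of the scaling factor
matters below. *)
Lemma flag_minor_scale a : a != 0 ->
  exists2 e, e != 0 & forall g, flag_minor (a *: g) = e * flag_minor g.
Proof.
move=> a_neq0; pose d : 'rV[F]_n := \row_q (if (rho hi <= rho q)%N then a else 1).
exists (\det (diag_mx d)) => [|g].
  rewrite det_diag; apply/prodf_neq0 => q _; rewrite mxE.
  by case: ifP => // _; exact: oner_neq0.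
rewrite mulrC -det_mulmx; congr (\det _); apply/matrixP => p q.
rewrite mul_mx_diag !mxE; case: ifP => _; last by rewrite mulr1.
by rewrite mulrC.
Qed.

(** The value of t is the root of the affine function
[flag_minor (g *m x (- t))], and the minor has no zero in the cell of v, so
[in_cell_descent] leaves only the cell of [v * s]. *)
Lemma in_cell_peel g : in_cell v g -> flag_minor (g *m perm_mx s) != 0 ->
  let t := flag_minor g / flag_minor (g *m perm_mx s) in
  t != 0 /\ in_cell (v * s)%g (g *m x (- t)).
Proof.
move=> cell_g f'_neq0 t; have f_neq0 := flag_minor_cell cell_g.
split; first by rewrite mulf_neq0 ?invr_eq0.
have [/flag_minor_cell|//] := in_cell_descent (- t) v_desc cell_g.
by rewrite flag_minor_elementary mulNr divfK // subrr eqxx.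
Qed.

End Borel.

(** * The exchange property of the symmetric group *)

Section Exchange.
Local Open Scope group_scope.
Variable r : nat.
Implicit Types (w : 'S_r.+1) (i : 'I_r).
Local Notation lo i := (widen_ord (leqnSn r) i).
Local Notation hi i := (lift ord0 i).

Lemma coxeter_length_word w :
  exists2 c, word_prod c = w & size c = coxeter_length w.
Proof.
rewrite /coxeter_length; case: ex_minnP => k /existsP[c /eqP Dw] _.
by exists c; rewrite ?size_tuple.
Qed.

Lemma coxeter_length_le (c : seq 'I_r) : (coxeter_length (word_prod c) <= size c)%N.
Proof.
rewrite /coxeter_length; case: ex_minnP => k _; apply; apply/existsP.
by exists (in_tuple c).
Qed.

Lemma word_prod_rcons c i : word_prod (rcons c i) = word_prod c * simple_refl i.
Proof. by rewrite /word_prod -cats1 big_cat big_seq1. Qed.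

Lemma simple_reflK i : simple_refl i * simple_refl i = 1.
Proof. exact: tperm2. Qed.

Lemma coxeter_length_step w i :
  (coxeter_length (w * simple_refl i) <= (coxeter_length w).+1)%N.
Proof.
have [c Dw <-] := coxeter_length_word w.
by rewrite -Dw -word_prod_rcons -(size_rcons c i) coxeter_length_le.
Qed.

Lemma simple_refl_reverses j (a b : 'I_r.+1) :
  (b < a)%N -> (simple_refl j a < simple_refl j b)%N -> b = lo j /\ a = hi j.
Proof.
rewrite /simple_refl; do 2![case: tpermP => [->|->|/eqP+ /eqP+]];
  rewrite -?val_eqE //= /bump leq0n //; lia.
Qed.

(** The deleted letter is the one at which the order of the two coordinates gets
reversed when the letters are applied one after the other. *)
Lemma word_exchange (c : seq 'I_r) i :
    ((word_prod c)^-1 (hi i) < (word_prod c)^-1 (lo i))%N ->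
  exists2 c', word_prod c' = word_prod c * simple_refl i & (size c').+1 = size c.
Proof.
elim: c => [|j c IHc]; rewrite /word_prod.
  by rewrite big_nil invg1 !perm1 /= /bump leq0n; lia.
rewrite big_cons -/(word_prod c) invMg !permM /simple_refl tpermV -/(simple_refl i).
set a := (word_prod c)^-1 (hi i); set b := (word_prod c)^-1 (lo i) => desc.
have [lt_ab|le_ba] := ltnP a b.
  have [c' Dc' szc'] := IHc lt_ab; exists (j :: c'); last by rewrite /= szc'.
  by rewrite /word_prod big_cons -/(word_prod c') Dc' mulgA.
have lt_ba : (b < a)%N.
  rewrite ltn_neqAle le_ba andbT (inj_eq val_inj) (inj_eq perm_inj).
  by rewrite -val_eqE /= /bump leq0n neq_ltn leqnn.
have [eq_b eq_a] := simple_refl_reverses lt_ba desc.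
exists c; last by [].
(* The letter j does the reversal, and deleting it amounts to multiplying by s_i. *)
have -> : simple_refl i = simple_refl j ^ word_prod c.
  by rewrite /simple_refl tpermJ -eq_a -eq_b !permKV.
by rewrite conjgE !mulgA -(mulgA (simple_refl j)) mulgV mulg1 simple_reflK mul1g.
Qed.

Lemma ascent_of_length w i :
  (coxeter_length w < coxeter_length (w * simple_refl i))%N ->
  (w^-1 (lo i) < w^-1 (hi i))%N.
Proof.
have [c Dw szc] := coxeter_length_word w; apply: contraTT.
rewrite -!leqNgt leq_eqVlt => /orP[|].
  by rewrite (inj_eq val_inj) (inj_eq perm_inj) -val_eqE /= /bump /=; lia.
rewrite -Dw => /word_exchange[c' <- szc']; rewrite Dw -szc -szc'.
by rewrite (leq_trans (coxeter_length_le c')).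
Qed.

End Exchange.

(** * Polynomial functions of a matrix *)

Section PolynomialFunctions.
Import GRing.Theory.
Local Open Scope ring_scope.
Variables (C : fieldType) (m : nat).
Local Notation M := 'M[C]_m.

Definition polynomial_fun (f : M -> C) :=
  exists p : {mpoly C[m * m]}, forall g, f g = p.@[mxvec g 0].

Lemma polynomial_fun_const c : polynomial_fun (fun=> c).
Proof. by exists c%:MP => g; rewrite mevalC. Qed.

Lemma polynomial_fun_entry p q : polynomial_fun (fun g => g p q).
Proof. by exists 'X_(mxvec_index p q) => g; rewrite mevalXU mxvecE. Qed.

Lemma polynomial_funD f1 f2 :
  polynomial_fun f1 -> polynomial_fun f2 -> polynomial_fun (fun g => f1 g + f2 g).
Proof. by move=> [p Dp] [q Dq]; exists (p + q) => g; rewrite mevalD Dp Dq. Qed.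

Lemma polynomial_funM f1 f2 :
  polynomial_fun f1 -> polynomial_fun f2 -> polynomial_fun (fun g => f1 g * f2 g).
Proof. by move=> [p Dp] [q Dq]; exists (p * q) => g; rewrite mevalM Dp Dq. Qed.

Lemma polynomial_fun_sum (I : Type) (s : seq I) (P : pred I) (f : I -> M -> C) :
  (forall k, polynomial_fun (f k)) ->
  polynomial_fun (fun g => \sum_(k <- s | P k) f k g).
Proof.
move=> /choice[p Dp]; exists (\sum_(k <- s | P k) p k) => g.
by rewrite raddf_sum; apply: eq_bigr.
Qed.

Lemma polynomial_fun_prod (I : Type) (s : seq I) (P : pred I) (f : I -> M -> C) :
  (forall k, polynomial_fun (f k)) ->
  polynomial_fun (fun g => \prod_(k <- s | P k) f k g).
Proof.
move=> /choice[p Dp]; exists (\prod_(k <- s | P k) p k) => g.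
by rewrite rmorph_prod; apply: eq_bigr.
Qed.

Definition polynomial_map (phi : M -> M) :=
  forall p q, polynomial_fun (fun g => phi g p q).

Lemma polynomial_fun_comp f phi :
  polynomial_fun f -> polynomial_map phi -> polynomial_fun (f \o phi).
Proof.
move=> [P DP] phi_poly.
have /choice[Q DQ] (k : 'I_(m * m)) : exists Q : {mpoly C[m * m]},
    forall g, mxvec (phi g) 0 k = Q.@[mxvec g 0].
  case/mxvec_indexP: k => p q; have [Q DQ] := phi_poly p q.
  by exists Q => g; rewrite mxvecE.
exists (P \mPo [tuple Q k | k < m * m]) => g /=.
by rewrite DP comp_mpoly_meval; apply: meval_eq => k; rewrite tnth_mktuple.
Qed.

Lemma polynomial_fun_det phi :
  polynomial_map phi -> polynomial_fun (fun g => \det (phi g)).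
Proof.
move=> phi_poly; apply: polynomial_fun_sum => s.
apply: polynomial_funM; first exact: polynomial_fun_const.
by apply: polynomial_fun_prod => p; exact: phi_poly.
Qed.

Lemma polynomial_map_mulr (A : M) : polynomial_map (fun g => g *m A).
Proof.
move=> p q.
have [P DP] : polynomial_fun (fun g => \sum_k g p k * A k q).
  apply: polynomial_fun_sum => k.
  by apply: polynomial_funM; [exact: polynomial_fun_entry | exact: polynomial_fun_const].
by exists P => g; rewrite mxE.
Qed.

Lemma polynomial_flag_minor (rho : 'I_m -> 'I_m) hi v :
  polynomial_fun (flag_minor rho hi v).
Proof.
apply: polynomial_fun_det => p q.
have [P DP] : polynomial_fun (fun g =>
    if (rho hi <= rho q)%N then g p q else (perm_mx v : M) p q).
  by case: (rho hi <= _)%N; [exact: polynomial_fun_entry | exact: polynomial_fun_const].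
by exists P => g; rewrite -DP mxE.
Qed.

(** Column operations with polynomial coefficients, the form in which a factor
[elementary a b t] is removed after clearing the denominator of t. *)
Lemma polynomial_map_col_op (A : M) f1 f2 :
    polynomial_fun f1 -> polynomial_fun f2 ->
  polynomial_map (fun g => f1 g *: g - f2 g *: (g *m A)).
Proof.
move=> f1_poly f2_poly p q.
have [P DP] : polynomial_fun (fun g => f1 g * g p q + -1 * (f2 g * (g *m A) p q)).
  apply: polynomial_funD.
    exact: (polynomial_funM f1_poly (polynomial_fun_entry p q)).
  apply: polynomial_funM (polynomial_fun_const _) _.
  exact: (polynomial_funM f2_poly (polynomial_map_mulr A p q)).
by exists P => g; rewrite -DP mulN1r !mxE.
Qed.

End PolynomialFunctions.

(** * Double reduced words *)

Section Words.
Variable r : nat.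
Implicit Types (uv : 'S_r.+1 * 'S_r.+1) (i : letter r) (w : seq (letter r)).
Local Notation coxl := (@coxeter_length r).

(** The component of a pair of permutations on which letters of a given kind
act, so that barred and unbarred letters are treated at once. *)
Definition acted (b : bool) uv : 'S_r.+1 := if b then uv.1 else uv.2.

Lemma acted_mul_letter b uv i :
  acted b (mul_letter uv i) =
  if b == i.1 then (acted b uv * simple_refl i.2)%g else acted b uv.
Proof. by case: b i uv => [] [[] j] [u v]. Qed.

Lemma mul_letterK uv i : mul_letter (mul_letter uv i) i = uv.
Proof.
by case: uv i => u v [[] j]; rewrite /mul_letter /= -mulgA simple_reflK mulg1.
Qed.

Lemma terminal_letterP uv i :
  (i \in terminal_letters uv) =
  (coxl (acted i.1 uv * simple_refl i.2)%g < coxl (acted i.1 uv))%N.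
Proof.
rewrite inE; case: uv i => u v [[] j];
  by rewrite /coxeter_length2 /= (ltn_add2l, ltn_add2r).
Qed.

(** Multiplication by a letter changes the length by at most one, so the word
obtained by removing or adding a last letter is reduced as soon as the length
moves in the expected direction. *)
Lemma double_reduced_rcons uv i w :
  double_reduced_words uv (rcons w i) <->
  i \in terminal_letters uv /\ double_reduced_words (mul_letter uv i) w.
Proof.
have red_rcons v c j : reduced_word v (rcons c j) <->
    (coxl (v * simple_refl j)%g < coxl v)%N /\ reduced_word (v * simple_refl j)%g c.
  rewrite /reduced_word word_prod_rcons size_rcons.
  have step := coxeter_length_step (v * simple_refl j)%g j.
  rewrite -mulgA simple_reflK mulg1 in step.
  split=> [[Dv szc]|[lt_len [Dc szc]]]; last first.
    by rewrite Dc -mulgA simple_reflK mulg1; split=> //; lia.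
  have Dc : word_prod c = (v * simple_refl j)%g by rewrite -Dv -mulgA simple_reflK mulg1.
  by have := coxeter_length_le c; rewrite Dc => le_c; split; [lia|split=> //; lia].
rewrite terminal_letterP /double_reduced_words /barred_subword /unbarred_subword /=.
rewrite !filter_rcons; case: uv i => u v [[] j] /=; rewrite map_rcons red_rcons; tauto.
Qed.

Lemma double_reduced_exists uv : exists w, double_reduced_words uv w.
Proof.
have [c Dc szc] := coxeter_length_word uv.1.
have [d Dd szd] := coxeter_length_word uv.2.
exists ([seq (true, j) | j <- c] ++ [seq (false, j) | j <- d]).
rewrite /double_reduced_words /barred_subword /unbarred_subword /reduced_word /=.
rewrite !filter_cat !filter_map !map_cat /preim /= !filter_predT !filter_pred0 cats0 /=.
by rewrite -!map_comp !map_id.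
Qed.

Lemma double_reduced_nil uv : double_reduced_words uv [::] -> uv = (1%g, 1%g).
Proof.
by case: uv => u v [[/= <- _] [<- _]]; rewrite /word_prod big_nil.
Qed.

End Words.

(** * Double Bruhat cells, torus charts and the deep locus *)

Section Cells.
Import GRing.Theory.
Local Open Scope ring_scope.
Local Open Scope classical_set_scope.
Variables (R : realType) (r : nat).
Local Notation C := R[i].
Local Notation M := 'M[C]_r.+1.
Implicit Types (uv : 'S_r.+1 * 'S_r.+1) (i : letter r) (w : seq (letter r)) (g : M).

(** The upper triangular Borel subgroup is [borel (coord_order true)] and the
lower triangular one is [borel (coord_order false)]. *)
Definition coord_order (b : bool) : 'I_r.+1 -> 'I_r.+1 :=
  if b then @rev_ord r.+1 else id.

Lemma coord_order_inj b : injective (coord_order b).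
Proof. by case: b => //; exact: rev_ord_inj. Qed.

(** The order of the two coordinates is the one of [coord_order i.1], so that
[x_ i t] lies outside the Borel subgroup whose cells the letter i changes. *)
Definition letter_lo i : 'I_r.+1 :=
  if i.1 then lift ord0 i.2 else widen_ord (leqnSn r) i.2.
Definition letter_hi i : 'I_r.+1 :=
  if i.1 then widen_ord (leqnSn r) i.2 else lift ord0 i.2.

Lemma letter_lo_hi i :
  coord_order i.1 (letter_hi i) = (coord_order i.1 (letter_lo i)).+1 :> nat.
Proof. by case: i => [[] [j ltj]] //=; rewrite /bump /=; lia. Qed.

Lemma x_elementary i (t : C) : x_ i t = elementary (letter_lo i) (letter_hi i) t.
Proof. by case: i => [[] j]. Qed.

Lemma simple_refl_letter i : simple_refl i.2 = tperm (letter_lo i) (letter_hi i).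
Proof. by case: i => [[] j] //; rewrite /simple_refl tpermC. Qed.

Lemma letter_ascent i (w : 'S_r.+1) :
    (coxeter_length w < coxeter_length (w * simple_refl i.2)%g)%N ->
  (coord_order i.1 (w^-1 (letter_lo i))%g < coord_order i.1 (w^-1 (letter_hi i))%g)%N.
Proof.
move/ascent_of_length; case: i => [[] j] //=.
rewrite /letter_lo /letter_hi /=.
by move: (w^-1 _)%g (w^-1 _)%g => a b lt_ba; have := ltn_ord a; lia.
Qed.

Lemma borelP b g :
  (if b then @Bplus R r else @Bminus R r) g <->
  \det g = 1 /\ triangular (coord_order b) g.
Proof.
have -> : triangular (coord_order b) g <-> is_trig_mx (if b then g^T else g).
  split=> [tri|/is_trig_mxP tri p q].
    apply/is_trig_mxP => p q lt_pq; case: b tri => tri;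
      rewrite ?mxE tri //=; have := ltn_ord q; lia.
  case: b tri => /= tri lt_pq; last exact: tri.
  by have := tri q p; rewrite mxE; apply; have := ltn_ord p; have := ltn_ord q; lia.
by case: b.
Qed.

Lemma diag_triangular key (d : 'rV[C]_r.+1) : triangular key (diag_mx d).
Proof. by move=> p q lt_pq; rewrite mxE; case: eqP lt_pq => [->|//]; rewrite ltnn. Qed.

(** Invertible Borel factors are normalized to determinant 1 by diagonal
matrices, absorbed into the representative of w. *)
Lemma double_cosetP b (w : 'S_r.+1) g :
  double_coset (if b then @Bplus R r else @Bminus R r) w g <->
  \det g = 1 /\ in_cell (coord_order b) w g.
Proof.
split.
  move=> [b1 [wd [b2 [/borelP[d1 t1] [dw [d Dw]] /borelP[d2 t2] ->]]]].
  have dw1 : \det wd = 1 by exact: dw.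
  split; first by rewrite !det_mulmx d1 dw1 d2 !mulr1.
  exists (b1 *m diag_mx d), b2; split; last by rewrite Dw -!mulmxE !mulmxA.
    split; first by apply: triangular_mul t1 _; exact: diag_triangular.
    have: wd \in unitmx by rewrite unitmxE dw1 unitr1.
    rewrite Dw -mulmxE unitmx_mul => /andP[du _].
    by rewrite unitmx_mul du unitmxE d1 unitr1.
  by split=> //; rewrite unitmxE d2 unitr1.
move=> [dg [b1 [b2 [[t1 u1] [t2 u2] Dg]]]].
(* A diagonal matrix of prescribed determinant c. *)
pose e (c : C) : 'rV[C]_r.+1 := \row_q (if q == ord0 then c else 1).
have det_e c : \det (diag_mx (e c)) = c.
  rewrite det_diag (bigD1 ord0) //= mxE eqxx big1 ?mulr1 // => q /negPf neq.
  by rewrite mxE neq.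
have eK c : c != 0 -> diag_mx (e c) *m diag_mx (e c^-1) = 1%:M.
  move=> c_neq0; rewrite mulmx_diag -diag_const_mx; congr diag_mx.
  by apply/rowP => q; rewrite !mxE; case: ifP; rewrite ?mulr1 ?mulfV.
have := u1; have := u2; rewrite !unitmxE !unitfE => d2 d1.
have perm_diag (d : 'rV[C]_r.+1) : perm_mx w *m diag_mx d =
    diag_mx (\row_q d 0 (w q)) *m perm_mx w.
  apply/matrixP => p q; rewrite mul_perm_mx mul_diag_mx !mxE.
  by case: eqP => [->|]; rewrite ?mulr0 ?mulr1 ?mulr1n.
exists (b1 *m diag_mx (e (\det b1)^-1)).
exists (diag_mx (e (\det b1)) *m perm_mx w *m diag_mx (e (\det b2))).
exists (diag_mx (e (\det b2)^-1) *m b2).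
have -> : b1 *m diag_mx (e (\det b1)^-1) *
    (diag_mx (e (\det b1)) *m perm_mx w *m diag_mx (e (\det b2))) *
    (diag_mx (e (\det b2)^-1) *m b2) = g.
  rewrite -!mulmxE !mulmxA -(mulmxA b1) -{2}[\det b1]invrK eK ?invr_eq0 //.
  by rewrite mulmx1 -(mulmxA (b1 *m perm_mx w)) eK // mulmx1.
split=> //.
- apply/borelP; rewrite det_mulmx det_e mulfV //; split=> //.
  by apply: triangular_mul t1 _; exact: diag_triangular.
- split; last first.
    by rewrite /= -mulmxA perm_diag mulmxA mulmx_diag; eexists.
  by rewrite /SL /= !det_mulmx !det_e -!det_mulmx -Dg.
- apply/borelP; rewrite det_mulmx det_e mulVf //; split=> //.
  by apply: triangular_mul t2; exact: diag_triangular.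
Qed.

Lemma bruhat_cellP uv g :
  bruhat_cell uv g <->
  \det g = 1 /\ forall b, in_cell (coord_order b) (acted b uv) g.
Proof.
split.
  move=> [/(double_cosetP true)[dg c1] /(double_cosetP false)[_ c2]].
  by split; [exact: dg | case].
move=> [dg cells]; split.
  by apply/(double_cosetP true); split; last exact: (cells true).
by apply/(double_cosetP false); split; last exact: (cells false).
Qed.

Lemma det_x i (t : C) : \det (x_ i t) = 1.
Proof.
rewrite x_elementary (det_triangular (key := coord_order (~~ i.1))).
- apply: big1 => p _; rewrite /elementary !mxE eqxx.
  case: (p =P letter_lo i) => [->|_]; last by rewrite mulr0 addr0.
  by rewrite (negPf (neq_lohi (letter_lo_hi i))) mulr0 addr0.
- by move=> p q /val_inj/coord_order_inj.
- apply: elementary_triangular.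
  by case: i => [[] [j ltj]] //=; rewrite /bump /=; lia.
Qed.

Lemma x_opposite_borel i (t : C) : borel (coord_order (~~ i.1)) (x_ i t).
Proof.
split; last by rewrite unitmxE det_x unitr1.
rewrite x_elementary; apply: elementary_triangular.
by case: i => [[] [j ltj]] //=; rewrite /bump /=; lia.
Qed.

Lemma xK i (t : C) : x_ i t * x_ i (- t) = 1.
Proof. by rewrite !x_elementary -mulmxE elementaryK // (neq_lohi (letter_lo_hi i)). Qed.

Section TerminalLetter.
Variables (uv : 'S_r.+1 * 'S_r.+1) (i : letter r).
Hypothesis i_term : i \in terminal_letters uv.
Let rho := coord_order i.1.
Let v := acted i.1 uv.
Let lo_hi := letter_lo_hi i.

Lemma terminal_descent : (rho (v^-1 (letter_hi i))%g < rho (v^-1 (letter_lo i))%g)%N.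
Proof.
have := @letter_ascent i (v * simple_refl i.2)%g.
rewrite -mulgA simple_reflK mulg1 -terminal_letterP => /(_ i_term).
by rewrite invMg !permM simple_refl_letter tpermV tpermL tpermR.
Qed.

(** On the image of the product map, g' x_i(t) has parameter t equal to
[pivot_num] divided by [pivot_den]. *)
Definition pivot_num g := flag_minor rho (letter_hi i) v g.
Definition pivot_den g := pivot_num (g *m perm_mx (simple_refl i.2)).

(** The component of i goes up by [in_cell_ascent]; for the other component
[x_ i t] is in the Borel subgroup. *)
Lemma bruhat_cell_mul g (t : C) : t != 0 ->
  bruhat_cell (mul_letter uv i) g -> bruhat_cell uv (g * x_ i t).
Proof.
move=> t_neq0 /bruhat_cellP[dg cells]; apply/bruhat_cellP.
split=> [|b]; first by rewrite -mulmxE det_mulmx det_x dg mulr1.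
rewrite -[uv in acted _ uv](mul_letterK _ i) acted_mul_letter -mulmxE.
case: eqP => [->|/eqP neq_b]; last first.
  have -> : b = ~~ i.1 by case: b i.1 neq_b => [] [].
  exact: in_cell_mulr (x_opposite_borel _ _) (cells _).
rewrite x_elementary simple_refl_letter.
apply: (in_cell_ascent (@coord_order_inj _) lo_hi) => //.
apply: letter_ascent; rewrite acted_mul_letter eqxx -mulgA simple_reflK mulg1.
by rewrite -terminal_letterP.
Qed.

Lemma pivot_mul g (t : C) : bruhat_cell (mul_letter uv i) g ->
  pivot_den (g * x_ i t) = pivot_den g /\
  pivot_den g != 0 /\ t = pivot_num (g * x_ i t) / pivot_den (g * x_ i t).
Proof.
move=> /bruhat_cellP[_ /(_ i.1)]; rewrite acted_mul_letter eqxx => cell_g.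
rewrite /pivot_den /pivot_num -mulmxE x_elementary simple_refl_letter in cell_g *.
rewrite flag_minor_elementary_swap // flag_minor_elementary //.
have [-> f'_neq0] :=
  flag_minor_cell_swap (@coord_order_inj _) lo_hi terminal_descent cell_g.
by split=> //; split=> //; rewrite add0r mulfK.
Qed.

(** With [pivot_mul], this identifies the products g' x_i(t), t <> 0, with the
points of the cell where [pivot_den] does not vanish. *)
Lemma pivot_peel g : bruhat_cell uv g -> pivot_den g != 0 ->
  let t := pivot_num g / pivot_den g in
  t != 0 /\ bruhat_cell (mul_letter uv i) (g * x_ i (- t)).
Proof.
move=> /bruhat_cellP[dg cells] den_neq0 t.
have := den_neq0; rewrite /pivot_den simple_refl_letter => den_neq0'.
have [] := in_cell_peel (@coord_order_inj _) lo_hi terminal_descent (cells _) den_neq0'.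
rewrite -simple_refl_letter -/(pivot_den g) -/(pivot_num g) -/t -x_elementary.
move=> t_neq0 cell_i; split=> //; apply/bruhat_cellP.
split=> [|b]; first by rewrite -mulmxE det_mulmx det_x dg mulr1.
rewrite acted_mul_letter; case: eqP => [->//|/eqP neq_b].
have -> : b = ~~ i.1 by case: b i.1 neq_b => [] [].
exact: in_cell_mulr (x_opposite_borel _ _) (cells _).
Qed.

Lemma pivot_scale a : a != 0 ->
  exists2 e, e != 0 & forall g, pivot_num (a *: g) = e * pivot_num g /\
                                pivot_den (a *: g) = e * pivot_den g.
Proof.
move=> /(flag_minor_scale rho (letter_hi i) v)[e e_neq0 De]; exists e => // g.
by rewrite /pivot_den /pivot_num -scalemxAl !De.
Qed.

Lemma polynomial_pivot_num : polynomial_fun pivot_num.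
Proof. exact: polynomial_flag_minor. Qed.

Lemma polynomial_pivot_den : polynomial_fun pivot_den.
Proof.
exact: (polynomial_fun_comp polynomial_pivot_num (polynomial_map_mulr _)).
Qed.

Lemma mul_x_factor_uniq g h t t' :
  bruhat_cell (mul_letter uv i) g -> bruhat_cell (mul_letter uv i) h ->
  g * x_ i t = h * x_ i t' -> g = h.
Proof.
move=> /(@pivot_mul _ t)[_ [_ Dt]] /(@pivot_mul _ t')[_ [_ Dt']] eq_gh.
have eq_t : t = t'.
  rewrite Dt Dt'; exact: (congr1 (fun y => pivot_num y / pivot_den y) eq_gh).
have := congr1 ( *%R^~ (x_ i (- t))) eq_gh.
by rewrite /= -eq_t -!mulrA xK !mulr1.
Qed.

End TerminalLetter.

Lemma torus_bruhat_cell g : torus g <-> bruhat_cell (1%g, 1%g) g.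
Proof.
split=> [[/(borelP true)[dg t1] /(borelP false)[_ t2]]|/bruhat_cellP[dg cells]].
  apply/bruhat_cellP; split=> // b; exists g, 1%:M; split.
  - by split; [case: b | rewrite unitmxE dg unitr1].
  - by split; [exact: triangular1 | exact: unitmx1].
  - by case: b; rewrite /= perm_mx1 !mulmx1.
have tri b : triangular (coord_order b) g.
  have [b1 [b2 [[t1 _] [t2 _] ->]]] := cells b.
  have -> : acted b (1%g, 1%g) = 1%g by case: b {cells b1 b2 t1 t2}.
  by rewrite perm_mx1 mulmx1; exact: triangular_mul.
by split; [apply/(borelP true) | apply/(borelP false)].
Qed.

Lemma torus_chart_nil g : torus_chart [::] g <-> torus g.
Proof.
split=> [[h [t [th /size0nil-> _ ->]]]|tg].
  by rewrite big_nil mulr1.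
by exists g, [::]; split; rewrite // big_nil mulr1.
Qed.

Lemma torus_chart_rcons w i g :
  torus_chart (rcons w i) g <->
  exists g' t, [/\ torus_chart w g', t != 0 & g = g' * x_ i t].
Proof.
split=> [[h [t [th]]]|[g' [z [[h [t [th szt allt ->]]] z_neq0 ->]]]].
  case/lastP: t => [|t z]; first by rewrite size_rcons.
  rewrite !size_rcons all_rcons => -[szt] /andP[z_neq0 allt].
  rewrite zip_rcons // -cats1 big_cat big_seq1 mulrA => ->.
  by eexists _, z; split=> //; exists h, t.
exists h, (rcons t z); split=> //.
- by rewrite !size_rcons szt.
- by rewrite all_rcons z_neq0.
- by rewrite zip_rcons // -cats1 big_cat big_seq1 mulrA.
Qed.

(** Each letter of a reduced word raises the cell, by [bruhat_cell_mul]. *)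
Lemma torus_chart_bruhat_cell w uv g :
  double_reduced_words uv w -> torus_chart w g -> bruhat_cell uv g.
Proof.
elim/last_ind: w uv g => [|w i IHw] uv g.
  by move=> /double_reduced_nil-> /torus_chart_nil/torus_bruhat_cell.
move=> /double_reduced_rcons[i_term red_w].
move=> /torus_chart_rcons[g' [t [chart_g' t_neq0 ->]]].
exact: bruhat_cell_mul i_term _ _ t_neq0 (IHw _ _ red_w chart_g').
Qed.

(** The factor g' of g, multiplied by [pivot_den] to make it polynomial in g. *)
Definition peeled uv i g : M :=
  pivot_den uv i g *: g -
  pivot_num uv i g *: (g *m delta_mx (letter_lo i) (letter_hi i)).

Lemma polynomial_peeled uv i : polynomial_map (peeled uv i).
Proof.
exact: (polynomial_map_col_op _ (polynomial_pivot_den _ _) (polynomial_pivot_num _ _)).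
Qed.

Lemma peeledE uv i g : pivot_den uv i g != 0 ->
  peeled uv i g =
  pivot_den uv i g *: (g * x_ i (- (pivot_num uv i g / pivot_den uv i g))).
Proof.
move=> den_neq0; rewrite x_elementary /elementary mulrDr mulr1 scalerDr.
by rewrite scaleNr mulrN scalerN -scalerAr scalerA mulrC divfK.
Qed.

Lemma peeled_scale uv i a : a != 0 ->
  exists2 e, e != 0 & exists2 e', e' != 0 & forall g,
    pivot_den uv i (a *: g) = e * pivot_den uv i g /\
    peeled uv i (a *: g) = e' *: peeled uv i g.
Proof.
move=> a_neq0; have [e e_neq0 De] := pivot_scale uv i a_neq0.
exists e => //; exists (e * a); rewrite ?mulf_neq0 // => g.
have [num_e den_e] := De g; split=> //; rewrite /peeled; move: num_e den_e.
move: (pivot_num uv i) (pivot_den uv i) => num den -> ->.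
by rewrite -scalemxAl scalerBr !scalerA ![e * _ * a]mulrAC.
Qed.

(** Stability of the zero locus under scaling lets the induction evaluate the
equation of the shorter word at [peeled], a multiple of the factor g'. *)
Lemma torus_chart_equation uv w : double_reduced_words uv w ->
  exists f, [/\ polynomial_fun f,
    forall a g, a != 0 -> (f (a *: g) == 0) = (f g == 0)
  & forall g, bruhat_cell uv g -> (f g != 0 <-> torus_chart w g)].
Proof.
elim/last_ind: w uv => [|w i IHw] uv.
  move=> /double_reduced_nil->; exists (fun=> 1); split=> //.
    exact: polynomial_fun_const.
  by move=> g /torus_bruhat_cell/torus_chart_nil; rewrite oner_neq0.
move=> /double_reduced_rcons[i_term red_w].
have [f [f_poly f_scale f_chart]] := IHw _ red_w.
exists (fun g => pivot_den uv i g * f (peeled uv i g)); split.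
- apply: polynomial_funM; first exact: polynomial_pivot_den.
  exact: (polynomial_fun_comp f_poly (polynomial_peeled _ _)).
- move=> a g a_neq0; have [e e_neq0 [e' e'_neq0 De]] := peeled_scale uv i a_neq0.
  have [den_e ->] := De g.
  have mul_eq0 d y y' : (y == 0) = (y' == 0) -> (e * d * y == 0) = (d * y' == 0 :> C).
    by move=> eq_y; rewrite !mulf_eq0 (negPf e_neq0) eq_y.
  by rewrite den_e; apply: mul_eq0; exact: f_scale.
move=> g cell_g; rewrite mulf_eq0 negb_or torus_chart_rcons; split.
  move=> /andP[den_neq0]; rewrite peeledE // f_scale //.
  have [t_neq0 cell_g'] := pivot_peel i_term cell_g den_neq0.
  move=> /(f_chart _ cell_g') chart_g'; do 2!eexists.
  split; [exact: chart_g' | exact: t_neq0 |].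
  by rewrite -mulrA -{2}[_ / _]opprK xK mulr1.
move=> [g' [t [chart_g' t_neq0 Dg]]].
have cell_g' := torus_chart_bruhat_cell red_w chart_g'.
have [den_eq [den_neq0 Dt]] := pivot_mul i_term t cell_g'.
rewrite -Dg in den_eq Dt; rewrite den_eq den_neq0 peeledE den_eq //.
rewrite f_scale // -den_eq -Dt Dg -mulrA xK mulr1.
exact/(f_chart _ cell_g').
Qed.

Lemma zariski_closed_zeros (f : M -> C) :
  polynomial_fun f -> zariski_closed [set g | f g = 0].
Proof.
move=> [P DP]; exists [set P]; apply/seteqP; split=> g /=.
  by move=> fg0 _ ->; rewrite -DP.
by move/(_ _ erefl); rewrite DP.
Qed.

(** The closure is cut out by all polynomials that vanish on A. *)
Lemma zariski_closure_closed (A : set M) :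
  zariski_closed (\bigcap_(Z in [set Z | zariski_closed Z /\ A `<=` Z]) Z).
Proof.
exists [set P | forall g, A g -> P.@[mxvec g 0] = 0]; apply/seteqP; split=> g /=.
  move=> clg P PA; have := clg [set h | P.@[mxvec h 0] = 0]; apply; split=> //.
  by apply: zariski_closed_zeros; exists P.
by move=> gP _ [[S ->] AS] P SP; apply: gP => h /AS; exact.
Qed.

Lemma D0E uv i : i \in terminal_letters uv ->
  D0 R uv i = bruhat_cell uv `&` [set g | pivot_den uv i g = 0].
Proof.
move=> i_term; apply/seteqP; split=> g [cell_g].
  move=> not_mul; split=> //=; apply: contra_notP not_mul => /eqP den_neq0.
  have [t_neq0 cell_g'] := pivot_peel i_term cell_g den_neq0.
  eexists; [exact: cell_g' | eexists; [eexists; [exact: t_neq0 | by []] |]].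
  by rewrite -mulrA -{2}[_ / _]opprK xK mulr1.
move=> den0; split=> // -[g' cell_g' [_ [t t_neq0 <-] Dg]].
have [den_eq [/eqP]] := pivot_mul i_term t cell_g'.
by rewrite -den_eq Dg den0.
Qed.

(** If g = g' x_i(t) and g' is on the chart of w, then g is on the chart of w
followed by i; so the factor of a deep point is deep. *)
Lemma deep_locus_sub_D uv i : i \in terminal_letters uv ->
  deep_locus R uv `<=` D0 R uv i `|` D1 R uv i.
Proof.
move=> i_term g [cell_g not_chart].
have [in_mul|] := pselect (set_mul (bruhat_cell (mul_letter uv i)) (x_Cstar i) g);
  last by left.
right; split=> // Z [_]; apply; case: in_mul => g' cell_g' [y [t t_neq0 Dy] Dg].
exists g'; last by exists y => //; exists t.
split=> // -[w red_w chart_g']; apply: not_chart; exists (rcons w i).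
  exact/double_reduced_rcons.
by apply/torus_chart_rcons; exists g', t; rewrite -Dg -Dy.
Qed.

(** The equation of the chart vanishes on the products h x_i(t) with h deep, by
uniqueness of the factor h, hence on their closure. *)
Lemma D1_not_chart uv i w g : i \in terminal_letters uv ->
  double_reduced_words (mul_letter uv i) w ->
  D1 R uv i g -> ~ torus_chart (rcons w i) g.
Proof.
move=> i_term red_w [cell_g closure_g] chart_g.
have red_wi : double_reduced_words uv (rcons w i) by exact/double_reduced_rcons.
have [f [f_poly _ f_chart]] := torus_chart_equation red_wi.
have /eqP[] := (f_chart g cell_g).2 chart_g.
apply: (closure_g [set h | f h = 0]); split; first exact: zariski_closed_zeros.
move=> _ [h [cell_h deep_h] [_ [t t_neq0 <-] <-]] /=.
have cell_hx := bruhat_cell_mul i_term t_neq0 cell_h.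
apply/eqP; apply: contraT => /(f_chart _ cell_hx).
case/torus_chart_rcons=> [h' [t' [chart_h' _ eq_h]]].
case: deep_h; exists w => //.
have cell_h' := torus_chart_bruhat_cell red_w chart_h'.
by rewrite (mul_x_factor_uniq i_term cell_h cell_h' eq_h).
Qed.

Lemma deep_locus_eq uv : uv <> (1%g, 1%g) ->
  deep_locus R uv =
  \bigcap_(i in [set` terminal_letters uv]) (D0 R uv i `|` D1 R uv i).
Proof.
move=> uv_neq1; apply/seteqP; split=> [g deep_g i /= i_term|g caps_g].
  exact: deep_locus_sub_D.
split=> [|[w]].
  have [w] := double_reduced_exists uv.
  case/lastP: w => [/double_reduced_nil //|w i /double_reduced_rcons[i_term _]].
  by have [[]|[]] := caps_g i i_term.
case/lastP: w => [/double_reduced_nil //|w i /double_reduced_rcons[i_term red_w] chart_g].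
have [[cell_g]|/(D1_not_chart i_term red_w)//] := caps_g i i_term.
apply; have [g' [t [chart_g' t_neq0 ->]]] := (torus_chart_rcons w i g).1 chart_g.
exists g'; first exact: torus_chart_bruhat_cell chart_g'.
by exists (x_ i t) => //; exists t.
Qed.

(** D0 and D1 are both traces on the cell of Zariski closed sets. *)
Lemma irreducible_sub_Dk uv i (Y : set M) : i \in terminal_letters uv ->
    irreducible Y -> Y `<=` deep_locus R uv ->
  exists k, Y `<=` Dk R uv i k.
Proof.
move=> i_term [_ irrY] subY.
have cellY : Y `<=` bruhat_cell uv by move=> g /subY[].
pose Z0 := [set g | pivot_den uv i g = 0].
pose Z1 := \bigcap_(Z in [set Z | zariski_closed Z /\
  set_mul (deep_locus R (mul_letter uv i)) (x_Cstar i) `<=` Z]) Z.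
have [||g Yg|Y0|Y1] := irrY Z0 Z1.
- exact/zariski_closed_zeros/polynomial_pivot_den.
- exact: zariski_closure_closed.
- by have := deep_locus_sub_D i_term (subY g Yg); rewrite D0E // => -[] []; [left|right].
- by exists false; rewrite /Dk D0E // => g Yg; split; [exact: cellY | exact: Y0].
- by exists true => g Yg; split; [exact: cellY | exact: Y1].
Qed.

End Cells.

Local Open Scope classical_set_scope.

Theorem theorem1p6 (R : realType) (r : nat) (u v : 'S_r.+1) :
  ((u, v) <> (1%g, 1%g) ->
     deep_locus R (u, v) =
       \bigcap_(i in [set` terminal_letters (u, v)])
         (D0 R (u, v) i `|` D1 R (u, v) i)
  /\ deep_locus R (u, v) =
       \bigcup_(k in [set: {i | i \in terminal_letters (u, v)} -> bool])
         \bigcap_(i in [set: {i | i \in terminal_letters (u, v)}])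
           Dk R (u, v) (val i) (k i))
  /\ forall Y : set 'M[R[i]]_r.+1,
       irreducible_component (deep_locus R (u, v)) Y ->
       exists k : {i | i \in terminal_letters (u, v)} -> bool,
         Y `<=` \bigcap_(i in [set: {i | i \in terminal_letters (u, v)}])
                  Dk R (u, v) (val i) (k i).
Proof.
split=> [uv_neq1|Y [subY irrY _]].
  have deepE := deep_locus_eq R uv_neq1; split; rewrite deepE //.
  apply/seteqP; split=> [g caps_g|g [k _ caps_g] i i_term].
    have /choice[k Dk_g] (i : {i | i \in terminal_letters (u, v)}) :
        exists b, Dk R (u, v) (val i) b g.
      by have [D0g|D1g] := caps_g _ (valP i); [exists false | exists true].
    by exists k.
  by have := caps_g (Sub i i_term) I; rewrite /Dk /=; case: ifP => _ ?; [right | left].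
have /choice[k subDk] (i : {i | i \in terminal_letters (u, v)}) :
    exists b, Y `<=` Dk R (u, v) (val i) b.
  exact: irreducible_sub_Dk (valP i) irrY subY.
by exists k => g Yg i _; exact: subDk.
Qed.
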